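(* Let $\tau\in\mathcal S$. Let $(\mathcal Q,d)$ be a metric space and $y,z,q,p\in\mathcal Q$. Assume there is $L\in[2,\infty)$ such that $$d(y,q)^2-d(y,p)^2-d(z,q)^2+d(z,p)^2\le L\,d(q,p)\,d(y,z).$$ Then $$\tau(d(y,q))-\tau(d(y,p))-\tau(d(z,q))+\tau(d(z,p))\le L\,d(q,p)\,\tau'(d(y,z)).$$
   Context: $\mathcal S$ is the set of nondecreasing, convex functions $\tau\colon[0,\infty)\to\mathbb R$ that are differentiable on $(0,\infty)$ with concave derivative $\tau'$; $\tau'$ is extended to $0$ by $\tau'(0):=\lim_{x\searrow0}\tau'(x)$. *)

(* Defs.v *)
From HB Require Import structures.
From mathcomp Require Import all_boot all_order all_algebra.
From mathcomp Require Import all_classical all_reals all_analysis.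

Set Implicit Arguments.
Unset Strict Implicit.
Unset Printing Implicit Defensive.

Import Order.TTheory GRing.Theory Num.Theory.
Import numFieldNormedType.Exports.

Local Open Scope classical_set_scope.
Local Open Scope ring_scope.

Definition concave_function (R : numFieldType) (E : lmodType R)
    (D : set (convex_lmodType E)) (f : convex_lmodType E -> R^o) : Prop :=
  convex_function D (fun x => - f x).

(* A function [0, oo) -> R is represented by a total function R -> R of which
   only the values on [0, oo) matter; the derivative [derive1 tau] is only used at
   interior points, where it does not depend on the values at negative reals. *)
Definition classS (R : realType) : set (R -> R) :=
  [set tau : R -> R |
    [/\ {in `[0, +oo[ &, {homo tau : x y / x <= y}},
        convex_function (`[0, +oo[%classic : set R^o) tau,
        {in `]0, +oo[, forall x : R, derivable tau x 1} &
        concave_function (`]0, +oo[%classic : set R^o) (derive1 tau)]].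

(* The limit always exists when [tau] is in [classS], [derive1 tau] being
   nondecreasing and nonnegative on (0, oo). *)
Definition derive1_ext0 (R : realType) (tau : R -> R) (x : R) : R :=
  if x == 0 then lim (derive1 tau t @[t --> 0^'+]) else derive1 tau x.

(* Main.v *)
Require Import Defs.
From mathcomp Require Import all_boot all_order all_algebra.
From mathcomp Require Import all_classical all_reals all_analysis.
From mathcomp Require Import ring lra.
Set Implicit Arguments.
Unset Strict Implicit.

Import Order.TTheory GRing.Theory Num.Theory.
Import numFieldNormedType.Exports.
Local Open Scope classical_set_scope.
Local Open Scope ring_scope.

(** Write [f] for the derivative of [tau], and let
    [a = d(y,q)], [b = d(y,p)], [c = d(z,q)], [e = d(z,p)], [s = d(q,p)] and
    [t = d(y,z)].  When [t = 0] the left-hand side vanishes and [f(0+) >= 0], so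
    let [t > 0].

    The left-hand side is the integral of [f] over [[b, a]] minus its integral
    over [[e, c]].  Describe these intervals by their midpoints [m], [n] and
    half-lengths [w], [v]; by the triangle inequality [|2w|, |2v| <= s] and
    [|m - n| <= t], while the quadratic hypothesis says
    [4wm - 4vn <= L s t].  Integrals are avoided: the integral over
    [[m - w, m + w]] is [spread tau m w], the increment of [tau], and everything
    needed about it follows by comparing derivatives in [w]:
    - midpoint concavity of [f] bounds the growth of the spread in [w] by
      [2 f(m)] per unit of [w], and [f(m) <= f(t) max(1, m/t)]
      ([spread_growth_scaled]);
    - shifting the centre to the right by [d] raises the spread by at most
      [2 v f(d)], because a nonnegative concave function is subadditive
      ([spread_shift]), and shifting it to the left does not raise it
      ([spread_center_monotone]).

    If [b <= a] and [c <= e], both increments contribute positively.  By the first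
    tool, applied to their growth from half-length [0], they add up to at most
    [((a - b) max(1, m/t) + (e - c) max(1, n/t)) f(t)].  The quadratic hypothesis
    bounds [(a - b) m/t + (e - c) n/t] by [L s / 2], and each term whose maximum is
    [1] is at most [s <= L s / 2].

    If [b <= a] and [e <= c] with [w <= v], shrink the second interval to the
    half-length [w] and shift: the difference is at most [2w f(t) <= s f(t)].
    With [v < w], cut the first interval into its central part of half-length [v]
    and the rest, of total length [2(w - v)].  If [m < t], these contribute at most
    [2v f(t)] and [2(w - v) f(t)], together at most [s f(t)].  If [m >= t], the
    hypothesis in the form [2(w - v) m <= L s t / 2 + 2v (n - m)] bounds the rest
    by [(L s / 2 + 2v (n - m) / t) f(t)].  For [m <= n] the central part
    contributes nothing and [2v (n - m) / t <= s]; for [m > n] it contributes at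
    most [2v f(t) <= s f(t)] and [n - m] is negative.  Both totals are at most
    [(L/2 + 1) s f(t) <= L s f(t)].

    The remaining sign patterns are trivial, or follow by exchanging
    [a] with [e] and [b] with [c]. *)

(** * Elementary properties of the class and of the derivative *)

Lemma classS_nondecreasing (R : realType) (tau : R -> R) (x y : R) :
  classS tau -> 0 <= x -> x <= y -> tau x <= tau y.
Proof.
move=> [mono _ _ _] x0 xy; apply: mono => //; rewrite in_itv /= andbT //.
exact: le_trans xy.
Qed.

Lemma classS_convex (R : realType) (tau : R -> R) (x y l : R) :
  classS tau -> 0 <= x -> 0 <= y -> 0 <= l <= 1 ->
  tau (l * x + (1 - l) * y) <= l * tau x + (1 - l) * tau y.
Proof.
move=> [_ cvx _ _] x0 y0 /andP[l0 l1].
by apply: (cvx (Itv01 l0 l1)); rewrite inE /= in_itv /= andbT.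
Qed.

Lemma classS_derivable (R : realType) (tau : R -> R) (x : R) :
  classS tau -> 0 < x -> derivable tau x 1.
Proof.
move=> [_ _ dtau _] x0; apply: dtau.
by rewrite in_itv /= andbT.
Qed.

Lemma derive1_classS_concave (R : realType) (tau : R -> R) (x y l : R) :
  classS tau -> 0 < x -> 0 < y -> 0 <= l <= 1 ->
  l * tau^`()%classic x + (1 - l) * tau^`()%classic y
  <= tau^`()%classic (l * x + (1 - l) * y).
Proof.
move=> [_ _ _ ccv] x0 y0 /andP[l0 l1]; rewrite -lerN2 opprD -!mulrN.
by apply: (ccv (Itv01 l0 l1)); rewrite inE /= in_itv /= andbT.
Qed.

(** For every [e > 0], [tau + e * id] is strictly increasing, so its derivative is
    nonnegative. *)
Lemma derive1_classS_ge0 (R : realType) (tau : R -> R) (x : R) :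
  classS tau -> 0 < x -> 0 <= tau^`()%classic x.
Proof.
move=> htau x0; apply/ler_addgt0Pr => e e0.
have dlin (z : R) : is_derive z 1 (fun u : R => e * u) e.
  by apply: is_derive_eq; rewrite scaler1 ?scaler0 ?addr0.
have dtau (z : R) : 0 < z -> is_derive z 1 tau (tau^`()%classic z).
  by move=> z0; rewrite derive1E; apply/derivableP/classS_derivable.
have dsum (z : R) : 0 < z ->
    is_derive z 1 (tau + *%R e) (tau^`()%classic z + e).
  by move=> z0; have := dtau _ z0 => ?; exact: is_deriveD.
have := @incr_derive1_ge0_itvy R (tau + *%R e) false 0 x.
rewrite derive1E (@derive_val _ _ _ _ _ _ _ (dsum _ x0)); apply.
- by move=> z; rewrite inE /= in_itv /= andbT => /dsum [].
- move=> u v; rewrite !in_itv /= !andbT => u0 v0 uv /=.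
  by rewrite ler_ltD ?ltr_pM2l// (classS_nondecreasing htau)// ltW.
- by rewrite in_itv /= andbT.
Qed.

(** A concave function that decreased somewhere would eventually be negative. *)
Lemma derive1_classS_nondecreasing (R : realType) (tau : R -> R) (x y : R) :
  classS tau -> 0 < x -> x <= y -> tau^`()%classic x <= tau^`()%classic y.
Proof.
move=> htau x0; rewrite le_eqVlt => /predU1P[->//|xy].
set f := tau^`()%classic; rewrite leNgt; apply/negP => fyx.
have fy0 : 0 <= f y by rewrite derive1_classS_ge0// (lt_trans x0).
have fx0 : 0 < f x := le_lt_trans fy0 fyx.
(* [y] is the combination of [x] and the far point [w] with a weight [l] so small
   that [(1 - l) * f x] still exceeds [f y]. *)
pose l := (f x - f y) / (2 * f x).
have lE : l * f x = (f x - f y) / 2 by rewrite /l; field; rewrite gt_eqF.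
have l0 : 0 < l by rewrite divr_gt0 ?subr_gt0 ?mulr_gt0.
have l1 : l <= 1 by rewrite ler_pdivrMr ?mulr_gt0//; lra.
pose w := x + (y - x) / l.
have w0 : 0 < w by rewrite addr_gt0// divr_gt0// subr_gt0.
have yE : l * w + (1 - l) * x = y by rewrite /w; field; rewrite gt_eqF.
have := @derive1_classS_concave R tau w x l htau w0 x0.
rewrite yE -/f (ltW l0) l1 => /(_ isT).
have : 0 <= l * f w by rewrite mulr_ge0 ?(ltW l0)// derive1_classS_ge0.
rewrite mulrBl lE; lra.
Qed.

(** The chord from a point near [0], where the value is nonnegative, to [(y, f y)]
    passes below [(x, f x)]; letting that point tend to [0] shows that [f x / x] is
    nonincreasing. *)
Lemma derive1_classS_star (R : realType) (tau : R -> R) (x y : R) :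
  classS tau -> 0 < x -> x <= y ->
  x * tau^`()%classic y <= y * tau^`()%classic x.
Proof.
move=> htau x0; rewrite le_eqVlt => /predU1P[->//|xy].
have y0 := lt_trans x0 xy.
set f := tau^`()%classic; rewrite leNgt; apply/negP => fyx.
have fx0 : 0 <= f x by rewrite derive1_classS_ge0.
have fxy : 0 < f y - f x.
  rewrite subr_gt0 -(ltr_pM2l x0) (le_lt_trans _ fyx)//.
  by rewrite ler_wpM2r// ltW.
(* [z] is half of the threshold below which the chord from [z] to [y] contradicts
   [fyx]. *)
pose z := (x * f y - y * f x) / (2 * (f y - f x)).
have zE : z * (f y - f x) = (x * f y - y * f x) / 2.
  by rewrite /z; field; rewrite gt_eqF.
have z0 : 0 < z by rewrite divr_gt0 ?subr_gt0 ?mulr_gt0.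
have zx : z < x.
  rewrite -(ltr_pM2r fxy) zE; have : x * f x <= y * f x by rewrite ler_wpM2r// ltW.
  by rewrite mulrBr; have := mulr_gt0 x0 fxy; rewrite mulrBr; lra.
have yz : 0 < y - z by rewrite subr_gt0 (lt_trans zx).
pose l := (y - x) / (y - z).
have l0 : 0 <= l by rewrite divr_ge0 ?ltW// subr_gt0.
have l1 : l <= 1 by rewrite ler_pdivrMr// mul1r lerD2l lerN2 ltW.
have xE : l * z + (1 - l) * y = x by rewrite /l; field; rewrite gt_eqF.
have := @derive1_classS_concave R tau z y l htau z0 y0.
rewrite xE -/f l0 l1 => /(_ isT).
have : 0 <= l * f z by rewrite mulr_ge0 // derive1_classS_ge0.
move=> lfz fxge; have : (1 - l) * f y <= f x by lra.
have -> : 1 - l = (x - z) / (y - z) by rewrite /l; field; rewrite gt_eqF.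
rewrite mulrAC ler_pdivrMr//; nra.
Qed.

(** Add up the star-shape bounds for [x] and [y] against [x + y]. *)
Lemma derive1_classS_subadd (R : realType) (tau : R -> R) (x y : R) :
  classS tau -> 0 < x -> 0 < y ->
  tau^`()%classic (x + y) <= tau^`()%classic x + tau^`()%classic y.
Proof.
move=> htau x0 y0; rewrite -(ler_pM2l (addr_gt0 x0 y0)).
have := @derive1_classS_star R tau x (x + y) htau x0.
have := @derive1_classS_star R tau y (x + y) htau y0.
rewrite lerDl lerDr (ltW x0) (ltW y0) => /(_ isT) + /(_ isT); lra.
Qed.

Lemma derive1_classS_midpoint (R : realType) (tau : R -> R) (m w : R) :
  classS tau -> 0 <= w -> w < m ->
  tau^`()%classic (m + w) + tau^`()%classic (m - w) <= 2 * tau^`()%classic m.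
Proof.
move=> htau w0 wm.
have := @derive1_classS_concave R tau (m + w) (m - w) 2^-1 htau.
have -> : 2^-1 * (m + w) + (1 - 2^-1) * (m - w) = m by lra.
have -> : 0 <= (2^-1 : R) <= 1 by apply/andP; split; lra.
move=> /(_ _ _ isT) h; have := h _ _; lra.
Qed.

(** Monotonicity and the star-shape property in one bound, free of case
    distinctions: [f x <= f t * max(1, x / t)]. *)
Lemma derive1_classS_scale (R : realType) (tau : R -> R) (t x : R) :
  classS tau -> 0 < t -> 0 < x ->
  t * tau^`()%classic x <= Num.max t x * tau^`()%classic t.
Proof.
move=> htau t0 x0; case: (leP t x) => tx; first exact: derive1_classS_star.
by rewrite ler_pM2l// derive1_classS_nondecreasing// ltW.
Qed.

Lemma derive1_ext0_ge0 (R : realType) (tau : R -> R) (x : R) :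
  classS tau -> 0 <= x -> 0 <= derive1_ext0 tau x.
Proof.
move=> htau; rewrite /derive1_ext0 le_eqVlt eq_sym.
have [->|_ /= x0] := eqVneq x 0; last exact: derive1_classS_ge0.
move=> _; apply: limr_ge.
  apply: nondecreasing_at_right_is_cvgr; near=> y.
    move=> u v; rewrite !in_itv /= => /andP[u0 _] _.
    exact: derive1_classS_nondecreasing.
  exists 0 => _ [u + <-]; rewrite /= in_itv /= => /andP[u0 _].
  exact: derive1_classS_ge0.
near=> y; apply: derive1_classS_ge0 => //; near: y; exact: nbhs_right_gt.
Unshelve. all: by end_near. Qed.

(** * Continuity up to the boundary *)

(** The values of [tau] at negative reals are arbitrary, so [tau] itself need not be
    continuous at [0]; [clamp0 tau] agrees with it on [[0, oo)] and is continuous on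
    the whole line. *)
Definition clamp0 (R : realType) (tau : R -> R) (x : R) := tau (Num.max x 0).

Lemma clamp0E (R : realType) (tau : R -> R) (x : R) :
  0 <= x -> clamp0 tau x = tau x.
Proof. by rewrite /clamp0 => /max_l ->. Qed.

Lemma is_derive_clamp0 (R : realType) (tau : R -> R) (x : R) :
  classS tau -> 0 < x -> is_derive x 1 (clamp0 tau) (tau^`()%classic x).
Proof.
move=> htau x0; apply: (@near_eq_is_derive _ _ _ tau).
  near=> y; rewrite clamp0E// ltW//; near: y; exact: lt_nbhsr.
rewrite derive1E; exact/derivableP/classS_derivable.
Unshelve. all: by end_near. Qed.

(** Convexity alone allows an upward jump of [tau] at [0], monotonicity excludes it:
    on [[0, 1]], [tau] lies between [tau 0] and its chord. *)
Lemma continuous_clamp0 (R : realType) (tau : R -> R) :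
  classS tau -> continuous (clamp0 tau).
Proof.
move=> htau x; have [x0|x0|->] := ltrgt0P x.
- have [dx _] := is_derive_clamp0 htau x0.
  exact/differentiable_continuous/derivable1_diffP.
- apply: cvg_near_cst; near=> y; rewrite /clamp0 !max_r//; first exact: ltW.
  by rewrite ltW//; near: y; exact: lt_nbhsl.
- rewrite /continuous_at clamp0E//.
  have up : tau 0 + `|y| * (tau 1 - tau 0) @[y --> (0 : R)] -->
      tau 0 + 0 * (tau 1 - tau 0).
    apply: cvgD; first exact: cvg_cst.
    apply: cvgMr_tmp; rewrite -[X in _ --> X](@normr0 _ R).
    exact: cvg_norm.
  rewrite mul0r addr0 in up.
  apply: (squeeze_cvgr _ (cvg_cst _) up).
  near=> y; have y1 : `|y| <= 1.
    by near: y; exact: (@nbhs0_le R R 1 ltr01).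
  rewrite /clamp0; set z := Num.max y 0.
  have z0 : 0 <= z by rewrite le_max lexx orbT.
  have zy : z <= `|y| by rewrite ge_max ler_norm normr_ge0.
  rewrite classS_nondecreasing//=.
  have := @classS_convex R tau 1 0 z htau ler01 (lexx _).
  rewrite z0 (le_trans zy y1) mulr1 mulr0 addr0 => /(_ isT).
  have := @classS_nondecreasing R tau 0 1 htau (lexx _) ler01; nra.
Unshelve. all: by end_near. Qed.

(** * Increments of a function over an interval with a given centre *)

(** Comparison of the integrals of [g'] and [h'] over [[u, v]], by the mean value
    theorem and hence without any integrability to check. *)
Lemma increment_le (R : realType) (g h g' h' : R -> R) (u v : R) :
  u <= v -> continuous g -> continuous h ->
  (forall w, u < w < v -> is_derive w 1 g (g' w)) ->
  (forall w, u < w < v -> is_derive w 1 h (h' w)) ->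
  (forall w, u < w < v -> g' w <= h' w) ->
  g v - g u <= h v - h u.
Proof.
move=> uv cg ch dg dh gh.
have dhg w : u < w < v -> is_derive w 1 (h - g) (h' w - g' w).
  by move=> uwv; have := dg w uwv; have := dh w uwv => ? ?; exact: is_deriveB.
have : (h - g) u <= (h - g) v.
  apply: (@ger0_derive1_le_cc _ (h - g) u v) => //.
  - by move=> w; rewrite in_itv /= => /dhg [].
  - move=> w; rewrite in_itv /= => uwv.
    by rewrite derive1E (@derive_val _ _ _ _ _ _ _ (dhg _ uwv)) subr_ge0 gh.
  - by apply: continuous_subspaceT => x; apply: cvgB; [exact: ch|exact: cg].
  - by rewrite in_itv /= lexx.
  - by rewrite in_itv /= lexx uv.
by rewrite /= !fctE; lra.
Qed.

(** The integral of the derivative over the interval of centre [m] and half-length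
    [w], for [0 <= w <= m]. *)
Definition spread (R : realType) (tau : R -> R) (m w : R) :=
  clamp0 tau (m + w) - clamp0 tau (m - w).

Lemma spread0 (R : realType) (tau : R -> R) (m : R) : spread tau m 0 = 0.
Proof. by rewrite /spread addr0 subr0 subrr. Qed.

Lemma spread_half (R : realType) (tau : R -> R) (a b : R) :
  0 <= a -> 0 <= b ->
  spread tau ((a + b) / 2) ((a - b) / 2) = tau a - tau b.
Proof.
move=> a0 b0; rewrite /spread -mulrDl -mulrBl.
have -> : (a + b + (a - b)) / 2 = a by lra.
have -> : (a + b - (a - b)) / 2 = b by lra.
by rewrite !clamp0E.
Qed.

Lemma continuous_spread (R : realType) (tau : R -> R) (m : R) :
  classS tau -> continuous (spread tau m).
Proof.
move=> htau x; apply: cvgB; apply: continuous_comp;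
  try exact: continuous_clamp0.
- by apply: cvgD; [exact: cvg_cst|exact: cvg_id].
- by apply: cvgB; [exact: cvg_cst|exact: cvg_id].
Qed.

Lemma is_derive_spread (R : realType) (tau : R -> R) (m w : R) :
  classS tau -> 0 <= w -> w < m ->
  is_derive w 1 (spread tau m)
    (tau^`()%classic (m + w) + tau^`()%classic (m - w)).
Proof.
move=> htau w0 wm.
have mDw : 0 < m + w by lra.
have mBw : 0 < m - w by lra.
have dD := is_derive_clamp0 htau mDw; have dB := is_derive_clamp0 htau mBw.
have dlD : is_derive w 1 (fun z : R => m + z) 1.
  by have := is_deriveD (is_derive_cst m w 1) (is_derive_id w 1); rewrite add0r.
have dlB : is_derive w 1 (fun z : R => m - z) (-1).
  by have := is_deriveB (is_derive_cst m w 1) (is_derive_id w 1); rewrite sub0r.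
have := is_deriveB (@is_derive1_comp _ _ (fun z => m + z) _ _ _ dD dlD)
                   (@is_derive1_comp _ _ (fun z => m - z) _ _ _ dB dlB).
by rewrite mulr1 mulrN1 opprK; exact.
Qed.

Lemma spread_monotone (R : realType) (tau : R -> R) (m v w : R) :
  classS tau -> v <= w -> spread tau m v <= spread tau m w.
Proof.
move=> htau vw; have mono x y : x <= y -> clamp0 tau x <= clamp0 tau y.
  move=> xy; rewrite /clamp0; apply: classS_nondecreasing => //.
    by rewrite le_max lexx orbT.
  by rewrite ge_max !le_max xy lexx orbT.
by rewrite lerB// mono; lra.
Qed.

Lemma spread_center_monotone (R : realType) (tau : R -> R) (m n v : R) :
  classS tau -> 0 <= v -> v <= m -> m <= n -> spread tau m v <= spread tau n v.
Proof.
move=> htau v0 vm mn.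
suff : spread tau m v - spread tau m 0 <= spread tau n v - spread tau n 0.
  by rewrite !spread0 !subr0.
pose f := tau^`()%classic.
apply: (increment_le v0 (g' := fun w => f (m + w) + f (m - w))
  (h' := fun w => f (n + w) + f (n - w))); try exact: continuous_spread.
- by move=> w /andP[w0 wv]; apply: is_derive_spread => //; lra.
- by move=> w /andP[w0 wv]; apply: is_derive_spread => //; lra.
- move=> w /andP[w0 wv].
  by rewrite lerD// derive1_classS_nondecreasing//; lra.
Qed.

Lemma is_derive_scale (R : realType) (k w : R) :
  is_derive w 1 (fun z : R => k * z) k.
Proof. by apply: is_derive_eq; rewrite scaler1 ?scaler0 ?addr0. Qed.

Lemma continuous_scale (R : realType) (k : R) : continuous (fun z : R => k * z).
Proof. by move=> x; apply: cvgMl_tmp; exact: cvg_id. Qed.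

(** The derivatives in the half-length are compared by subadditivity of [tau'] at
    both ends of the interval. *)
Lemma spread_shift (R : realType) (tau : R -> R) (n d v : R) :
  classS tau -> 0 <= v -> v <= n -> 0 < d ->
  spread tau (n + d) v <= spread tau n v + 2 * v * tau^`()%classic d.
Proof.
move=> htau v0 vn d0; set f := tau^`()%classic.
suff : spread tau (n + d) v - spread tau (n + d) 0 <=
    (spread tau n + *%R (2 * f d)) v - (spread tau n + *%R (2 * f d)) 0.
  by rewrite !fctE !spread0 mulr0 addr0 !subr0 (mulrAC _ v).
apply: (increment_le v0 (g' := fun w => f (n + d + w) + f (n + d - w))
  (h' := fun w => f (n + w) + f (n - w) + 2 * f d)).
- exact: continuous_spread.
- by move=> x; apply: cvgD; [exact: continuous_spread|exact: continuous_scale].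
- by move=> w /andP[w0 wv]; apply: is_derive_spread => //; lra.
- move=> w /andP[w0 wv]; apply: is_deriveD; last exact: is_derive_scale.
  by apply: is_derive_spread => //; lra.
- move=> w /andP[w0 wv].
  have := @derive1_classS_subadd R tau (n + w) d htau.
  have := @derive1_classS_subadd R tau (n - w) d htau.
  rewrite -!/f (addrAC n w) (addrAC n (- w)) => h1 h2.
  have := h1 _ d0; have := h2 _ d0; lra.
Qed.

(** Adding two pieces symmetrically around the centre costs at most their length
    times the derivative at the centre, by midpoint concavity. *)
Lemma spread_growth (R : realType) (tau : R -> R) (m v w : R) :
  classS tau -> 0 <= v -> v <= w -> w <= m ->
  spread tau m w - spread tau m v <= 2 * (w - v) * tau^`()%classic m.
Proof.
move=> htau v0 vw wm; set f := tau^`()%classic.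
suff : spread tau m w - spread tau m v <= 2 * f m * w - 2 * f m * v.
  by rewrite -mulrBr (mulrAC _ (f m)).
apply: (increment_le vw (g' := fun x => f (m + x) + f (m - x))
  (h' := fun=> 2 * f m)).
- exact: continuous_spread.
- exact: continuous_scale.
- by move=> x /andP[vx xw]; apply: is_derive_spread => //; lra.
- by move=> x _; exact: is_derive_scale.
- by move=> x /andP[vx xw]; apply: derive1_classS_midpoint => //; lra.
Qed.

Lemma spread_growth_scaled (R : realType) (tau : R -> R) (t m v w : R) :
  classS tau -> 0 < t -> 0 <= v -> v <= w -> w <= m ->
  t * (spread tau m w - spread tau m v)
  <= 2 * (w - v) * Num.max t m * tau^`()%classic t.
Proof.
move=> htau t0 v0 vw wm.
have [m0|m0] := leP m 0.
  have -> : w = v by lra.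
  by rewrite !subrr !(mulr0, mul0r).
have := derive1_classS_scale htau t0 m0.
have : 0 <= 2 * (w - v) by lra.
move=> h /(ler_wpM2l h) h1.
have h2 := ler_wpM2l (ltW t0) (spread_growth htau v0 vw wm).
lra.
Qed.

(** * The inequality for real numbers *)

(** Far from [0] each increment alone may exceed the bound, so the two must be
    compared; the hypotheses [|a - c| <= t] and [|b - e| <= t] enter through the
    distance between the midpoints of the two intervals. *)
Lemma quadruple_same_sign (R : realType) (tau : R -> R) (L a b c e s t : R) :
  classS tau -> 2 <= L -> 0 < t ->
  0 <= b -> b <= a -> 0 <= e -> e <= c ->
  a - b <= s -> c - e <= s -> `|a - c| <= t -> `|b - e| <= t ->
  a ^+ 2 - b ^+ 2 - c ^+ 2 + e ^+ 2 <= L * s * t ->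
  tau a - tau b - tau c + tau e <= L * s * tau^`()%classic t.
Proof.
move=> htau L2 t0 b0 ba e0 ec As Cs ac be hq.
have K0 := derive1_classS_ge0 htau t0.
set K := tau^`()%classic t in K0 *.
have -> : tau a - tau b - tau c + tau e = (tau a - tau b) - (tau c - tau e).
  by ring.
rewrite -(spread_half tau)//; last lra.
rewrite -(spread_half tau)//; last lra.
set m := (a + b) / 2; set n := (c + e) / 2.
set w := (a - b) / 2; set v := (c - e) / 2.
have v0 : 0 <= v by rewrite /v; lra.
have w0 : 0 <= w by rewrite /w; lra.
have vn : v <= n by rewrite /v /n; lra.
have wm : w <= m by rewrite /w /m; lra.
have vs : 2 * v <= s by rewrite /v; lra.
have ws : 2 * w <= s by rewrite /w; lra.
have mn : `|m - n| <= t.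
  by move: ac be; rewrite !ler_norml /m /n => /andP[? ?] /andP[? ?]; lra.
have {}hq : 4 * (w * m) - 4 * (v * n) <= L * s * t.
  by apply: le_trans hq; rewrite /w /m /v /n; lra.
clearbody m n v w; clear ac be As Cs ba ec b0 e0 a b c e.
move: mn; rewrite ler_norml => /andP[nm mn].
(* No sign of [m - n] is assumed: a shift to the left costs nothing. *)
have shift : forall u, 0 <= u -> u <= m -> u <= n ->
    spread tau m u <= spread tau n u + 2 * u * K.
  move=> u u0 um un.
  have uK : 0 <= 2 * u * K by rewrite !mulr_ge0.
  have [lemn|ltnm] := leP m n.
    by have := spread_center_monotone htau u0 um lemn; lra.
  have d0 : 0 < m - n by lra.
  have := spread_shift htau u0 un d0.
  have : tau^`()%classic (m - n) <= K by apply: derive1_classS_nondecreasing.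
  have : 0 <= 2 * u by lra.
  have -> : n + (m - n) = m by ring.
  move=> h /(ler_wpM2l h); lra.
have LsK : 2 * (s * K) <= L * s * K.
  by rewrite -mulrA ler_wpM2r// mulr_ge0//; lra.
have wK : 2 * w * K <= s * K by rewrite ler_wpM2r.
have vK : 2 * v * K <= s * K by rewrite ler_wpM2r.
have sK : 0 <= s * K by rewrite mulr_ge0//; lra.
have [wv|vw] := leP w v.
  have := shift w w0 wm (le_trans wv vn).
  have := spread_monotone n htau wv.
  lra.
have vm : v <= m by lra.
have grow := spread_growth_scaled htau t0 v0 (ltW vw) wm.
rewrite -/K in grow.
rewrite -(ler_pM2l t0).
(* [2 * (w - v)] is the length of the first interval outside its central part. *)
have excess : 2 * (w - v) * m * K <= (L * s * t / 2 + 2 * v * (n - m)) * K.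
  by rewrite ler_wpM2r//; lra.
have vK0 : 0 <= 2 * v * K by rewrite !mulr_ge0.
have tLsK := ler_wpM2l (ltW t0) LsK.
have twK := ler_wpM2l (ltW t0) wK.
have tvK := ler_wpM2l (ltW t0) vK.
have tvK0 := mulr_ge0 (ltW t0) vK0.
have tsK0 := mulr_ge0 (ltW t0) sK.
have [lemn|ltnm] := leP m n.
  have center : t * (spread tau m v - spread tau n v) <= 0.
    rewrite pmulr_rle0// subr_le0.
    exact: (spread_center_monotone htau v0 vm lemn).
  have nmt : 2 * v * K * (n - m) <= 2 * v * K * t by rewrite ler_wpM2l//; lra.
  by case: (leP t m) grow => _ grow; lra.
have center := ler_wpM2l (ltW t0) (shift v v0 vm vn).
have nmt : 0 <= 2 * v * K * (m - n) by rewrite mulr_ge0//; lra.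
by case: (leP t m) grow => _ grow; lra.
Qed.

(** Both increments contribute positively, and no comparison of their positions is
    needed: the quadratic hypothesis bounds the sum of the two parts weighted by
    their midpoints. *)
Lemma quadruple_opposite_sign (R : realType) (tau : R -> R) (L a b c e s t : R) :
  classS tau -> 2 <= L -> 0 < t ->
  0 <= b -> b <= a -> 0 <= c -> c <= e ->
  a - b <= s -> e - c <= s ->
  a ^+ 2 - b ^+ 2 - c ^+ 2 + e ^+ 2 <= L * s * t ->
  tau a - tau b - tau c + tau e <= L * s * tau^`()%classic t.
Proof.
move=> htau L2 t0 b0 ba c0 ce As Es hq.
have K0 := derive1_classS_ge0 htau t0.
have growth x y : 0 <= y -> y <= x -> t * (tau x - tau y)
    <= (x - y) * Num.max t ((x + y) / 2) * tau^`()%classic t.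
  move=> y0 yx; have w0 : 0 <= (x - y) / 2 by lra.
  have := @spread_growth_scaled R tau t ((x + y) / 2) 0 ((x - y) / 2)
    htau t0 (lexx _) w0.
  rewrite spread0 !subr0 spread_half//; last by lra.
  have -> : 2 * ((x - y) / 2) = x - y by lra.
  by apply; lra.
rewrite -(ler_pM2l t0).
have := growth a b b0 ba; have := growth e c c0 ce.
set K := tau^`()%classic t in K0 *.
set M := Num.max t ((a + b) / 2); set N := Num.max t ((e + c) / 2) => hN hM.
suff : (a - b) * M + (e - c) * N <= L * s * t.
  by move=> h; have := ler_wpM2r K0 h; lra.
have As' := ler_wpM2r (ltW t0) As; have Es' := ler_wpM2r (ltW t0) Es.
have s0 : 0 <= s by lra.
have Lst : 2 * (s * t) <= L * s * t by rewrite -mulrA ler_wpM2r// mulr_ge0// ltW.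
have ab0 : 0 <= (a - b) * (a + b) by apply: mulr_ge0; lra.
have ec0 : 0 <= (e - c) * (e + c) by apply: mulr_ge0; lra.
by rewrite /M /N; case: (leP t ((a + b) / 2)); case: (leP t ((e + c) / 2)); lra.
Qed.

Unset Implicit Arguments.

Theorem theorem22 (R : realType) (tau : R -> R) (htau : classS tau)
  (Q : metricType R) (y z q p : Q) (L : R) (hL : 2 <= L)
  (hquad : mdist y q ^+ 2 - mdist y p ^+ 2 - mdist z q ^+ 2 + mdist z p ^+ 2
           <= L * mdist q p * mdist y z) :
  tau (mdist y q) - tau (mdist y p) - tau (mdist z q) + tau (mdist z p)
  <= L * mdist q p * derive1_ext0 tau (mdist y z).
Proof.
have s0 := mdist_ge0 q p.
have [yz|yz] := eqVneq y z.
  rewrite yz; have -> u v : tau u - tau v - tau u + tau v = 0 by ring.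
  by rewrite !mulr_ge0 ?derive1_ext0_ge0 ?mdist_ge0 ?(le_trans _ hL).
have t0 : 0 < mdist y z by rewrite mdist_gt0.
rewrite /derive1_ext0 gt_eqF//.
have lip (u v w : Q) : `|mdist u v - mdist u w| <= mdist v w.
  rewrite ler_norml; have := metric_triangle u v w; have := metric_triangle u w v.
  by rewrite (metric_sym w v) => ? ?; apply/andP; split; lra.
have := lip p y z; have := lip q y z; have := lip z q p; have := lip y q p.
rewrite !(metric_sym q) (metric_sym p y) (metric_sym p z).
have := mdist_ge0 z p; have := mdist_ge0 z q.
have := mdist_ge0 y p; have := mdist_ge0 y q; move: hquad s0.
move: (mdist y q) (mdist y p) (mdist z q) (mdist z p) => a b c e.
rewrite (metric_sym p q); move: (mdist q p) (mdist y z) t0 => s t t0.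
move=> hq s0 a0 b0 c0 e0.
rewrite (ler_norml (a - b)) (ler_norml (c - e)).
move=> /andP[ba_s ab_s] /andP[ec_s ce_s] ac be.
have [ba|/ltW ab] := leP b a; have [ec|/ltW ce] := leP e c.
- exact: quadruple_same_sign.
- by apply: quadruple_opposite_sign => //; lra.
- have := classS_nondecreasing htau a0 ab.
  have := classS_nondecreasing htau e0 ec.
  have : 0 <= L * s * tau^`()%classic t.
    by rewrite !mulr_ge0 ?derive1_classS_ge0 ?(le_trans _ hL).
  lra.
(* The exchange of [y] with [z] and of [q] with [p] preserves the inequality. *)
- rewrite (distrC a c) in ac; rewrite (distrC b e) in be.
  have -> : tau a - tau b - tau c + tau e = tau e - tau c - tau b + tau a by ring.
  by apply: quadruple_same_sign => //; lra.
Qed.
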